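(* (Myopic list-decoding lemma.) Let $0<p<q<\tfrac12$ with $I_B(p,q)>I_J(q)$, and let the random codebook $\{\mathbf{x}_{ij}\}$, $1\le i\le N$, $1\le j\le L$, and the list decoder $\mathcal{L}(\cdot)$ be as defined in the context, with $c=r-t(q,\epsilon_d)I_J(q)>0$. For any typical $\mathbf{z}\in\mathcal{A}_{\mathbf{Z}}$ and any conditionally typical type class $\mathcal{T}_{\mathbf{X}|\mathbf{z}}(f^{xz}_{10},f^{xz}_{11})$ (i.e. $(f^{xz}_{10},f^{xz}_{11})\in\mathcal{F}^{xz}_n$), with probability at least $1-\exp(-2^{\mathcal{O}(\sqrt n)})$ over the code design, $$\sum_{i=1}^N\sum_{j=1}^L\mathbb{1}\Big\{\mathbf{x}_{ij}\in\mathcal{T}_{\mathbf{X}|\mathbf{z}}(f^{xz}_{10},f^{xz}_{11})\ \text{and}\ \mathbf{x}_{ij}\notin\mathcal{L}(\mathbf{x}_{ij}\oplus\mathbf{s})\Big\}<\exp(-n^{1/4})\cdot2^{c\sqrt n}$$ for all $\mathbf{s}\in\{0,1\}^n$ with $\mathrm{wt}_H(\mathbf{s})\le pn$.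
   Context: All logarithms are binary; integrality/rounding issues are ignored; $\epsilon_d\in(0,1)$ is fixed; $Q(x)=\frac{1}{\sqrt{2\pi}}\int_x^\infty e^{-u^2/2}du$; $$t(q,\epsilon_d)=\frac{2\sqrt{q(1-q)}}{1-2q}Q^{-1}\!\left(\frac{1-\epsilon_d}{2}\right),\quad I_J(q)=(1-2q)\log\frac{1-q}{q},$$ $$I_B(p,q)=\frac{p(q-1)}{q}\log\left(\frac{(q-p+pq)(1-p)}{p^2(1-q)}\right)+\log\left(\frac{q-p+pq}{pq}\right).$$ Convention: ''probability at least $1-\exp(-2^{\mathcal{O}(\sqrt n)})$'' means at least $1-\exp(-2^{\kappa\sqrt n})$ for some constant $\kappa>0$ and all sufficiently large $n$. Random codebook. $r=t(q,\epsilon_d)I_B(p,q)-\delta$ with $\delta>0$ small (so that $c=r-t(q,\epsilon_d)I_J(q)>0$), $N=2^{r\sqrt n}$, $L=n^3$, $\rho=t(q,\epsilon_d)/\sqrt n$. The codewords $\mathbf{x}_{ij}\in\{0,1\}^n$ are generated independently, each with i.i.d. Bern$(\rho)$ coordinates (''over the code design'' refers to this randomness). For vectors $\mathbf{a},\mathbf{b}\in\{0,1\}^n$, $f^{ab}_{uv}(\mathbf{a},\mathbf{b})=\frac1n|\{k:(a_k,b_k)=(u,v)\}|$, and $f^z_1(\mathbf{z})=\mathrm{wt}_H(\mathbf{z})/n$. List decoder: $\mathcal{L}(\mathbf{y})$ is the set of $\mathbf{x}$ (among codewords) with $$n f^{xy}_{10}(\mathbf{x},\mathbf{y})<\rho n\,\tfrac{p(1-q)}{q}(1+\varepsilon_1),\qquad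 n f^{xy}_{11}(\mathbf{x},\mathbf{y})>\rho n\Big(1-\tfrac{p(1-q)}{q}\Big)(1-\varepsilon_2),$$ $\varepsilon_1=\frac1{\log n}$, $\varepsilon_2=\frac{p-pq}{(q-p+pq)\log n}$. Typicality: with $\rho*q=\rho(1-q)+(1-\rho)q$, $\mathcal{A}_{\mathbf{Z}}=\{\mathbf{z}:(\rho*q)(1-n^{-1/4})\le f^z_1(\mathbf{z})\le(\rho*q)(1+n^{-1/4})\}$. For fixed $\mathbf{z}$, $\mathcal{T}_{\mathbf{X}|\mathbf{z}}(f^{xz}_{10},f^{xz}_{11})$ is the set of $\mathbf{x}\in\{0,1\}^n$ with $|\{k:(x_k,z_k)=(1,0)\}|=nf^{xz}_{10}$ and $|\{k:(x_k,z_k)=(1,1)\}|=nf^{xz}_{11}$. $\mathcal{F}^{xz}_n$ is the set of pairs $(f^{xz}_{10},f^{xz}_{11})$ with $nf^{xz}_{10},nf^{xz}_{11}$ nonnegative integers, $\rho q(1-n^{-1/8})\le f^{xz}_{10}\le\rho q(1+n^{-1/8})$ and $\rho(1-q)(1-n^{-1/8})\le f^{xz}_{11}\le\rho(1-q)(1+n^{-1/8})$. *)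

(* Defs.v *)
From HB Require Import structures.
From mathcomp Require Import all_boot all_order all_algebra.
From mathcomp Require Import all_classical all_reals all_analysis.

Set Implicit Arguments.
Unset Strict Implicit.
Unset Printing Implicit Defensive.

Import Order.TTheory GRing.Theory Num.Theory.
Import numFieldNormedType.Exports.

Local Open Scope classical_set_scope.
Local Open Scope ring_scope.

Section Quantities.
Context {R : realType}.
Implicit Types p q rho eps_d delta x y : R.

Definition log2 x : R := ln x / ln 2.

Definition Qfun x : R :=
  (Num.sqrt (2 * pi))^-1 *
  \int[lebesgue_measure]_(u in `[x, +oo[) expR (- (u ^+ 2) / 2).

(* Q is a decreasing bijection from the reals onto ]0, 1[, so the preimage
   picked here is unique for y in ]0, 1[; the default 0 is used only for y
   outside that interval. *)
Definition Qinv y : R := xget 0 [set x | Qfun x = y].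

Definition t_par q eps_d : R :=
  2 * Num.sqrt (q * (1 - q)) / (1 - 2 * q) * Qinv ((1 - eps_d) / 2).

Definition I_J q : R := (1 - 2 * q) * log2 ((1 - q) / q).

Definition I_B p q : R :=
  p * (q - 1) / q *
    log2 ((q - p + p * q) * (1 - p) / (p ^+ 2 * (1 - q)))
  + log2 ((q - p + p * q) / (p * q)).

Definition rate p q eps_d delta : R := t_par q eps_d * I_B p q - delta.

Definition c_par p q eps_d delta : R :=
  rate p q eps_d delta - t_par q eps_d * I_J q.

Definition rho_par q eps_d (n : nat) : R := t_par q eps_d / Num.sqrt n%:R.

(* The crossover parameter of two cascaded binary symmetric channels. *)
Definition bconv rho q : R := rho * (1 - q) + (1 - rho) * q.

Definition eps1 (n : nat) : R := 1 / log2 n%:R.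

Definition eps2 p q (n : nat) : R :=
  (p - p * q) / ((q - p + p * q) * log2 n%:R).

End Quantities.

Notation word n := {ffun 'I_n -> bool}.

Section Words.
Variable n : nat.
Implicit Types a b s x y z : word n.

Definition wtH a : nat := #|[pred k | a k]|.

Definition xorw a s : word n := [ffun k => a k (+) s k].

Definition joint_count (u v : bool) a b : nat :=
  #|[pred k | (a k, b k) == (u, v)]|.

Context {R : realType}.

Definition joint_freq (u v : bool) a b : R := (joint_count u v a b)%:R / n%:R.

Definition freq1 z : R := (wtH z)%:R / n%:R.

Definition typicalZ (rho q : R) : {set word n} :=
  [set z | bconv rho q * (1 - n%:R `^ (- 4^-1)) <= freq1 z
           <= bconv rho q * (1 + n%:R `^ (- 4^-1))].

Definition type_class z (f10 f11 : R) : {set word n} :=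
  [set x | ((joint_count true false x z)%:R == n%:R * f10)
           && ((joint_count true true x z)%:R == n%:R * f11)].

End Words.

Definition typical_types {R : realType} (n : nat) (rho q : R) : set (R * R) :=
  [set f : R * R | [/\ n%:R * f.1 \is a Num.nat,
    n%:R * f.2 \is a Num.nat,
    rho * q * (1 - n%:R `^ (- 8^-1)) <= f.1
      <= rho * q * (1 + n%:R `^ (- 8^-1)) &
    rho * (1 - q) * (1 - n%:R `^ (- 8^-1)) <= f.2
      <= rho * (1 - q) * (1 + n%:R `^ (- 8^-1))]].

Notation codebook N L n := {ffun 'I_N * 'I_L -> word n}.

Section Codebook.
Context {R : realType} {N L n : nat}.
Implicit Types C : codebook N L n.

(* Probability of E when the N * L * n bits of the codebook are i.i.d. Bern(rho)
   (a probability law as soon as 0 <= rho <= 1). *)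
Definition code_prob (rho : R) (E : pred (codebook N L n)) : R :=
  \sum_(C | E C)
    \prod_(ij : 'I_N * 'I_L) \prod_(k < n) (if C ij k then rho else 1 - rho).

Definition list_decoder (p q rho : R) C (y : word n) : {set word n} :=
  [set x in codom C |
    (n%:R * joint_freq true false x y <
       rho * n%:R * (p * (1 - q) / q) * (1 + eps1 n))
    && (n%:R * joint_freq true true x y >
       rho * n%:R * (1 - p * (1 - q) / q) * (1 - eps2 p q n))].

Definition num_undecoded (p q rho : R) C (T : {set word n}) (s : word n) : nat :=
  (\sum_(i < N) \sum_(j < L)
     ((C (i, j) \in T)
      && (C (i, j) \notin list_decoder p q rho C (xorw (C (i, j)) s))))%N.

End Codebook.

(* Main.v *)
(* A codeword x fails to be listed on output x + s only if x and s overlap in at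
   least rho n beta (1 + 1/(2 log n)) positions, where beta = p (1 - q) / q: the
   identity (1 - beta) eps2 = beta / log n turns a failure of the second decoding
   test into the same overlap condition as a failure of the first.

   The probability that a Bern(rho) word has the prescribed joint type with z and
   such an overlap is bounded by one exponential tilt, of weight (1-q)/q on the
   support of z, q/(1-q) off it, and e^lam on the support of s.  Since z is typical
   and wt(s) <= pn, this yields
     2^(- t I_J sqrt n) exp(O(n^(3/8)) - Omega(sqrt n / (log n)^2)),
   so the mean number of undecoded codewords is far below
   tau = exp(- n^(1/4)) 2^(c sqrt n).  Chernoff's bound over the independent
   codewords gives probability exp(- tau/4) for each s, which absorbs the union
   over the 2^n words s.  The asymptotics are polynomial in u = n^(1/32), with
   ln n <= 32 u. *)

Require Import Defs.
From mathcomp Require Import all_boot all_order all_algebra.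
From mathcomp Require Import all_classical all_reals all_analysis.
From mathcomp Require Import ring lra.

Set Implicit Arguments.
Unset Strict Implicit.
Unset Printing Implicit Defensive.

Import Order.TTheory GRing.Theory Num.Theory.
Import numFieldNormedType.Exports.

Local Open Scope classical_set_scope.
Local Open Scope ring_scope.

Lemma expR_le_inv1B {R : realType} (x : R) : x < 1 -> expR x <= (1 - x)^-1.
Proof.
move=> x1; rewrite -[x in expR x]opprK expRN lef_pV2 ?posrE ?expR_gt0 ?subr_gt0 //.
exact: expR_ge1Dx.
Qed.

Lemma ler_wsum {R : numDomainType} (I : finType) (P Q : pred I) (F : I -> R) :
  (forall i, 0 <= F i) -> (forall i, P i -> Q i) ->
  \sum_(i | P i) F i <= \sum_(i | Q i) F i.
Proof.
move=> F0 PQ; rewrite big_mkcond [leRHS]big_mkcond /=; apply: ler_sum => i _.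
by case: ifP => [/PQ ->//|_]; case: ifP.
Qed.

(** * The law of one random codeword *)

Definition word_prob {R : realType} (rho : R) n (x : word n) : R :=
  \prod_(k < n) (if x k then rho else 1 - rho).

Section WordProb.
Context {R : realType} (rho : R) (n : nat).
Hypothesis rho01 : 0 <= rho <= 1.

Let rho_ge0 : 0 <= rho. Proof. by case/andP: rho01. Qed.
Let onem_ge0 : 0 <= 1 - rho. Proof. by rewrite subr_ge0; case/andP: rho01. Qed.

Lemma word_prob_ge0 (x : word n) : 0 <= word_prob rho x.
Proof. by apply: prodr_ge0 => k _; case: ifP. Qed.

(** Independence of coordinates: the sum over words distributes into a product over positions, each
    factor being a Bernoulli generating function. *)
Lemma word_mgf (g : 'I_n -> R) :
  \sum_(x : word n) word_prob rho x * \prod_(k < n) (if x k then g k else 1)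
  = \prod_(k < n) (1 + rho * (g k - 1)).
Proof.
transitivity (\prod_(k < n) \sum_(b : bool)
    ((if b then rho else 1 - rho) * (if b then g k else 1))).
  rewrite bigA_distr_bigA; apply: eq_bigr => x _.
  by rewrite -big_split.
by apply: eq_bigr => k _; rewrite big_bool /=; ring.
Qed.

Lemma word_prob_sum1 : \sum_(x : word n) word_prob rho x = 1.
Proof.
transitivity (\prod_(k < n) (1 + rho * (1 - 1)) : R).
  rewrite -(word_mgf (fun=> 1)); apply: eq_bigr => x _.
  by rewrite [X in _ * X]big1 ?mulr1 // => k _; case: ifP.
by rewrite big1 // => k _; rewrite subrr mulr0 addr0.
Qed.

(** Markov's inequality for the exponential of the excess over [H]; then [1 + y <= exp y] in each
    factor makes the bound additive over positions. *)
Lemma word_chernoff (h : 'I_n -> R) (H : R) :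
  \sum_(x : word n | H <= \sum_(k < n | x k) h k) word_prob rho x
  <= expR (rho * \sum_(k < n) (expR (h k) - 1) - H).
Proof.
have mgfE (x : word n) : \prod_(k < n) (if x k then expR (h k) else 1)
    = expR (\sum_(k < n | x k) h k).
  by rewrite expR_sum [RHS]big_mkcond.
rewrite expRD mulr_sumr expR_sum.
apply: (@le_trans _ _ (\sum_(x : word n)
    word_prob rho x * expR (\sum_(k < n | x k) h k) * expR (- H))).
  rewrite big_mkcond; apply: ler_sum => x _; case: ifPn => [Hx|_].
    rewrite -mulrA -expRD ler_peMr ?word_prob_ge0 //.
    by rewrite -[leLHS]expR0 ler_expR subr_ge0.
  by rewrite !mulr_ge0 ?expR_ge0 ?word_prob_ge0.
rewrite -mulr_suml ler_wpM2r ?expR_ge0 //.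
under [leLHS]eq_bigr do rewrite -mgfE.
rewrite word_mgf; apply: ler_prod => k _; rewrite expR_ge1Dx andbT.
have -> : 1 + rho * (expR (h k) - 1) = (1 - rho) + rho * expR (h k) by ring.
by rewrite addr_ge0 ?mulr_ge0 ?expR_ge0.
Qed.

End WordProb.

(** * The law of the codebook *)

Section CodeProb.
Context {R : realType} (rho : R) (N L n : nat).
Hypothesis rho01 : 0 <= rho <= 1.
Implicit Types E F : pred (codebook N L n).

Let weight (C : codebook N L n) : R :=
  \prod_(ij : 'I_N * 'I_L) word_prob rho (C ij).

Let weight_ge0 C : 0 <= weight C.
Proof. by apply: prodr_ge0 => ij _; exact: word_prob_ge0. Qed.

Lemma code_prob_subset E F :
  (forall C, E C -> F C) -> code_prob rho E <= code_prob rho F.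
Proof. exact: ler_wsum. Qed.

Lemma code_mean_prod (G : word n -> R) :
  \sum_(C : codebook N L n)
     (\prod_ij word_prob rho (C ij)) * \prod_ij G (C ij)
  = (\sum_(x : word n) word_prob rho x * G x) ^+ (N * L).
Proof.
transitivity (\prod_(ij : 'I_N * 'I_L) \sum_(x : word n) word_prob rho x * G x).
  by rewrite bigA_distr_bigA; apply: eq_bigr => C _; rewrite -big_split.
by rewrite prodr_const card_prod !card_ord.
Qed.

Lemma code_prob_predC E :
  code_prob rho E = 1 - code_prob rho (predC E).
Proof.
have : \sum_(C : codebook N L n) weight C = 1.
  transitivity (\sum_(C : codebook N L n) weight C * \prod_(ij : 'I_N * 'I_L) 1).
    by apply: eq_bigr => C _; rewrite big1 ?mulr1.
  rewrite (code_mean_prod (fun=> 1)).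
  by under eq_bigr do rewrite mulr1; rewrite word_prob_sum1 expr1n.
by rewrite (bigID E) /= => <-; rewrite addrK.
Qed.

Lemma code_prob_exists (I : finType) (F : I -> pred (codebook N L n)) :
  code_prob rho (fun C => [exists s, F s C]) <= \sum_s code_prob rho (F s).
Proof.
rewrite /code_prob (exchange_big_dep xpredT) //= big_mkcond /=.
apply: ler_sum => C _; case: ifP => [/existsP[s sC]|_].
  by rewrite (bigD1 s) //= lerDl; apply: sumr_ge0 => ? _; exact: weight_ge0.
by apply: sumr_ge0 => ? _; exact: weight_ge0.
Qed.

(** Markov's inequality with weight 2 on each codeword in [B]: since [exp (1/2) <= 2], the product
    of weights dominates [exp (count / 2)], and its mean per codeword is [1 + P <= exp P]. *)
Lemma code_chernoff (B : pred (word n)) (tau : R) :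
  code_prob rho (fun C : codebook N L n =>
    tau <= (\sum_(i < N) \sum_(j < L) B (C (i, j)))%N%:R)
  <= expR ((N * L)%:R * (\sum_(x | B x) word_prob rho x) - tau / 2).
Proof.
have e2 : expR (2^-1 : R) <= 2.
  rewrite [leRHS](_ : 2 = (1 - 2^-1)^-1); last by field.
  by apply: expR_le_inv1B; lra.
set P := \sum_(x | B x) _.
pose G (x : word n) : R := if B x then 2 else 1.
have countE (C : codebook N L n) :
    expR ((\sum_(i < N) \sum_(j < L) B (C (i, j)))%N%:R / 2) <= \prod_ij G (C ij).
  rewrite (pair_big xpredT xpredT (fun i j => (B (C (i, j)) : nat))) /=.
  rewrite natr_sum mulr_suml expR_sum; apply: ler_prod => -[i j] _.
  rewrite expR_ge0 /= /G; case: (B _); first by rewrite mul1r.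
  by rewrite mul0r expR0.
apply: (@le_trans _ _ (\sum_(C : codebook N L n)
    weight C * \prod_ij G (C ij) * expR (- (tau / 2)))).
  rewrite /code_prob big_mkcond; apply: ler_sum => C _; case: ifPn => [tC|_].
    rewrite -mulrA ler_peMr ?weight_ge0 //.
    apply: le_trans (ler_wpM2r (expR_ge0 _) (countE C)).
    rewrite -expRD -[leLHS]expR0 ler_expR subr_ge0.
    by rewrite ler_pM2r ?invr_gt0.
  rewrite !mulr_ge0 ?expR_ge0 //.
  by apply: prodr_ge0 => ij _; rewrite /G; case: ifP.
rewrite -mulr_suml code_mean_prod expRD ler_wpM2r ?expR_ge0 //.
rewrite expRM_natl.
have P0 : 0 <= P by apply: sumr_ge0 => x _; exact: word_prob_ge0.
have -> : \sum_x word_prob rho x * G x = 1 + P.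
  rewrite -(word_prob_sum1 rho n) /P [X in _ = _ + X]big_mkcond -big_split.
  by apply: eq_bigr => x _ /=; rewrite /G; case: ifP => _; ring.
by rewrite lerXn2r ?nnegrE ?expR_ge0 ?addr_ge0 // expR_ge1Dx.
Qed.

End CodeProb.

(** * Joint types, overlaps with the noise, and decoding failures *)

Section Overlap.
Context {R : realType} (n : nat).
Implicit Types x z s : word n.

Definition overlap x s : nat := #|[pred k | x k && s k]|.

Lemma overlapE x s : (overlap x s)%:R = \sum_(k < n | x k) (s k)%:R :> R.
Proof.
rewrite /overlap -sum1_card natr_sum big_mkcond [RHS]big_mkcond /=.
by apply: eq_bigr => k _; rewrite inE; case: (x k); case: (s k).
Qed.

Lemma wtHE x : (wtH x)%:R = \sum_(k < n) (x k)%:R :> R.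
Proof.
rewrite /wtH -sum1_card natr_sum big_mkcond /=.
by apply: eq_bigr => k _; rewrite inE; case: (x k).
Qed.

Lemma wtH_joint x z :
  wtH x = (joint_count true false x z + joint_count true true x z)%N.
Proof.
rewrite /wtH /joint_count -!sum1_card !(big_mkcond (fun k => k \in _)) -big_split /=.
by apply: eq_bigr => k _; rewrite !inE !xpair_eqE; case: (x k); case: (z k).
Qed.

Lemma joint_count_xor10 x s : joint_count true false x (xorw x s) = overlap x s.
Proof.
apply: eq_card => k; rewrite !inE ffunE xpair_eqE.
by case: (x k); case: (s k).
Qed.

(** The [z] part of the tilt is constant on a type class, so membership in the class is charged
    through it without loss. *)
Lemma type_class_sum z x (f10 f11 l : R) : x \in type_class z f10 f11 ->
  \sum_(k < n | x k) (if z k then l else - l) = l * (n%:R * f11 - n%:R * f10).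
Proof.
rewrite inE => /andP[/eqP <- /eqP <-].
rewrite /joint_count -!sum1_card !natr_sum !(big_mkcond (fun k => k \in _)) /=.
rewrite big_mkcond -sumrB mulr_sumr /=; apply: eq_bigr => k _.
by rewrite !inE !xpair_eqE; case: (x k); case: (z k) => /=; ring.
Qed.

(* Chernoff bound for the tilt giving each 1 of x the weight exp(l) on the
   support of z and exp(-l) off it, times exp(lam) on the support of s. *)
Lemma type_overlap_prob z s (rho p l lam f10 f11 K : R) :
  0 <= rho <= 1 -> 0 <= l -> 0 <= lam <= 2^-1 -> (wtH s)%:R <= p * n%:R ->
  \sum_(x | (x \in type_class z f10 f11) && (K <= (overlap x s)%:R))
     word_prob rho x
  <= expR (rho * (expR (- l) * n%:R + (expR l - expR (- l)) * (wtH z)%:R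
             + expR l * (lam + 2 * lam ^+ 2) * (p * n%:R) - n%:R)
           - (l * (n%:R * f11 - n%:R * f10) + lam * K)).
Proof.
move=> rho01 l0 /andP[lam0 lam1] sp.
have [rho0 _] := andP rho01.
pose h (k : 'I_n) : R := (if z k then l else - l) + lam * (s k)%:R.
set H := l * (n%:R * f11 - n%:R * f10) + lam * K.
apply: le_trans (le_trans (word_chernoff rho01 h H) _).
  apply: ler_wsum => x; first exact: word_prob_ge0.
  case/andP=> xT Kx; rewrite big_split /= (type_class_sum _ xT) -mulr_sumr.
  by rewrite -overlapE lerD2l ler_wpM2l.
rewrite ler_expR lerB // ler_wpM2l //.
(* [1 / (1 - lam) <= 1 + lam + 2 lam^2] holds for [0 <= lam <= 1/2]. *)
have elam : expR lam <= 1 + (lam + 2 * lam ^+ 2).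
  apply: le_trans (expR_le_inv1B _) _; first by lra.
  by rewrite -[leLHS]div1r ler_pdivrMr; nra.
have le_pm : expR (- l) <= expR l by rewrite ler_expR; lra.
have b0 : 0 < expR l by exact: expR_gt0.
(* Off the support of [z] the noise term carries [exp (- l)]; raising this to [exp l] decouples [z]
   from [s], as if all noise fell on the support of [z]. *)
apply: (@le_trans _ _ (\sum_(k < n) (expR (- l) + (expR l - expR (- l)) * (z k)%:R
    + expR l * (lam + 2 * lam ^+ 2) * (s k)%:R - 1))).
  apply: ler_sum => k _; rewrite /h lerD2r expRD.
  case: (z k) (s k) => [] []; rewrite ?mulr1 ?mulr0 ?expR0 ?addr0 ?mulr1.
  - by nra.
  - by lra.
  - have a0 : 0 < expR (- l) by exact: expR_gt0.
    have X0 : 0 <= lam + 2 * lam ^+ 2 by nra.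
    by nra.
  - by lra.
rewrite !big_split /= -!mulr_sumr -!wtHE sumr_const card_ord sumrN sumr_const card_ord.
rewrite -(mulr_natr (expR (- l)) n) lerD2r lerD2l ler_wpM2l // mulr_ge0 ?expR_ge0 //.
by nra.
Qed.

(** The overlap is the weight of [x] minus its (1,1) count. A failure of the second test yields a
    relative excess [1 / log n]; half of it pays for the weight deficit [v], and half remains. *)
Lemma undecoded_overlap N L (C : codebook N L n) x z s (p q rho f10 f11 v : R) :
  0 < p -> p < q -> q < 1 -> 0 <= rho -> (1 < n)%N ->
  v <= p * (1 - q) / q / (2 * log2 n%:R) ->
  rho * n%:R * (1 - v) <= n%:R * f10 + n%:R * f11 ->
  x \in codom C -> x \in type_class z f10 f11 ->
  x \notin list_decoder p q rho C (xorw x s) ->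
  rho * n%:R * (p * (1 - q) / q) * (1 + 1 / (2 * log2 n%:R)) <= (overlap x s)%:R.
Proof.
move=> p0 pq q1 rho0 n1 vle wle xC xT.
have n0 : (n%:R : R) != 0 by rewrite pnatr_eq0; case: (n) n1.
have lg0 : 0 < log2 n%:R :> R.
  by rewrite /log2 divr_gt0 // ln_gt0 ?ltr1n.
rewrite inE xC /= negb_and -!leNgt.
have freqE u b : n%:R * joint_freq u b x (xorw x s)
    = (joint_count u b x (xorw x s))%:R :> R.
  by rewrite /joint_freq mulrCA divff ?mulr1.
rewrite !freqE joint_count_xor10.
have wtE : (overlap x s)%:R + (joint_count true true x (xorw x s))%:R
    = n%:R * f10 + n%:R * f11 :> R.
  rewrite -natrD -joint_count_xor10 -wtH_joint (wtH_joint x z) natrD.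
  by move: xT; rewrite inE => /andP[/eqP -> /eqP ->].
rewrite /eps1 /eps2.
set lg := log2 _ in lg0 vle *; set beta := p * (1 - q) / q in vle *.
have q0 : q != 0 by rewrite gt_eqF //; lra.
have r0 : q - p + p * q != 0 by rewrite gt_eqF //; nra.
have beta0 : 0 <= beta by rewrite /beta divr_ge0 ?mulr_ge0; lra.
have rn0 : 0 <= rho * n%:R by rewrite mulr_ge0.
have halfE : 1 / (2 * lg) = (1 / lg) / 2 by field; rewrite gt_eqF.
have il0 : 0 <= 1 / lg by rewrite divr_ge0 // ltW.
have -> : rho * n%:R * (1 - beta) * (1 - (p - p * q) / ((q - p + p * q) * lg))
    = rho * n%:R * (1 - beta - beta * (1 / lg)).
  by rewrite /beta; field; rewrite q0 r0 gt_eqF.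
move: vle; have -> : beta / (2 * lg) = beta * (1 / lg) / 2.
  by field; rewrite gt_eqF.
rewrite halfE; move: (1 / lg) il0 => il il0 vle /orP[|] ovle.
  apply: le_trans ovle; apply: ler_wpM2l; last by lra.
  exact: mulr_ge0.
by have := ler_wpM2l rn0 vle; nra.
Qed.

End Overlap.

(** * The exponent of the failure probability, in powers of [u = n^(1/32)] *)

Section Exponent.
Context {R : realType}.
Implicit Types p q t u : R.

(** The left side would vanish at [W = q n], because [q / (1 - q) + ba q = 1] with [ba] the
    difference of the two weights. Only the deviation of [W] is left, at most
    [n (2 rho + n^(-1/4))]. *)
Lemma tilt_typicalZ q t u (W : R) :
  0 < q -> q < 1 / 2 -> 0 < t -> 1 <= u ->
  W <= u ^+ 32 * (bconv (t / u ^+ 16) q * (1 + (u ^+ 8)^-1)) ->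
  t / u ^+ 16 * (q / (1 - q) * u ^+ 32 + ((1 - q) / q - q / (1 - q)) * W - u ^+ 32)
  <= ((1 - q) / q - q / (1 - q)) * (2 * t ^+ 2 + t * u ^+ 8).
Proof.
move=> q0 q2 t0 u1 Wle.
have u0 : 0 < u by lra.
set rho := t / u ^+ 16 in Wle *; set e := (u ^+ 8)^-1 in Wle.
set ba := (1 - q) / q - q / (1 - q).
have rho0 : 0 < rho by rewrite divr_gt0 ?exprn_gt0.
have e01 : 0 < e <= 1.
  by rewrite invr_gt0 exprn_gt0 //= invf_le1 ?exprn_gt0 // exprn_ege1.
have baE : ba = (1 - 2 * q) / (q * (1 - q)).
  by rewrite /ba; field; rewrite !gt_eqF //; lra.
have ba0 : 0 < ba by rewrite baE divr_gt0 ?mulr_gt0; lra.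
have oneE : q / (1 - q) = 1 - ba * q.
  by rewrite baE; field; rewrite !gt_eqF //; lra.
have n0 : 0 < u ^+ 32 by rewrite exprn_gt0.
have We : W <= u ^+ 32 * (q + 2 * rho + e).
  apply: le_trans Wle _; apply: ler_wpM2l; first exact: ltW.
  have [e0 e1] := andP e01.
  have rq0 : 0 <= rho * q by apply: mulr_ge0; lra.
  have rqe0 : 0 <= rho * q * e by apply: mulr_ge0; lra.
  have req0 : 0 <= e * (1 - q) by apply: mulr_ge0; lra.
  have re0 : 0 <= rho * (1 - e) by apply: mulr_ge0; lra.
  by rewrite /bconv; lra.
have -> : ba * (2 * t ^+ 2 + t * u ^+ 8)
    = rho * (ba * (u ^+ 32 * (2 * rho + e))).
  by rewrite /rho /e; field; rewrite gt_eqF // exprn_gt0.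
apply: ler_wpM2l; first exact: ltW.
by rewrite oneE; have := ler_wpM2l (ltW ba0) We; nra.
Qed.

(** The extreme admissible frequencies give the right side. For [l = ln ((1 - q) / q)] the leading
    term is [t I_J sqrt n] in natural units. *)
Lemma tilt_typical_types q t u l (f10 f11 : R) :
  0 < t -> 1 <= u -> 0 <= l ->
  f10 <= t / u ^+ 16 * q * (1 + (u ^+ 4)^-1) ->
  t / u ^+ 16 * (1 - q) * (1 - (u ^+ 4)^-1) <= f11 ->
  - (l * (u ^+ 32 * f11 - u ^+ 32 * f10))
  <= - (l * t * (1 - 2 * q) * u ^+ 16) + l * t * u ^+ 12.
Proof.
move=> t0 u1 l0 f10le f11ge.
have u0 : 0 < u by lra.
have n0 : 0 <= u ^+ 32 by rewrite exprn_ge0 // ltW.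
have -> : - (l * t * (1 - 2 * q) * u ^+ 16) + l * t * u ^+ 12
  = l * (u ^+ 32 * (t / u ^+ 16 * q * (1 + (u ^+ 4)^-1)
                    - t / u ^+ 16 * (1 - q) * (1 - (u ^+ 4)^-1))).
  by field; rewrite gt_eqF.
rewrite -mulrN opprB -mulrBr; apply: ler_wpM2l => //; apply: ler_wpM2l => //.
by rewrite lerB.
Qed.

(* The value lam = 1/(8 lg) is a near-optimal tilt for a relative excess 1/(2 lg). *)
Lemma tilt_overlap p q t u lg :
  0 < q -> 0 < u -> 0 < lg ->
  t / u ^+ 16 * ((1 - q) / q * (1 / (8 * lg) + 2 * (1 / (8 * lg)) ^+ 2)
                 * (p * u ^+ 32))
  - 1 / (8 * lg) * (t / u ^+ 16 * u ^+ 32 * (p * (1 - q) / q)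
                    * (1 + 1 / (2 * lg)))
  = - (t * (p * (1 - q) / q) * u ^+ 16 / (32 * lg ^+ 2)).
Proof.
by move=> q0 u0 lg0; field; rewrite !gt_eqF.
Qed.

(** Coefficient of the [u^12] error: the type deviation, then the weight deviation of [z]. *)
Definition exp_slack q t : R :=
  ln ((1 - q) / q) * t + ((1 - q) / q - q / (1 - q)) * (2 * t ^+ 2 + t).

(** Here [2^15] is 32 from the overlap tilt times [32^2] from [lg <= 32 u / ln 2], which lowers
    [u^16] to [u^14]. *)
Definition exp_gain p q t : R := t * (p * (1 - q) / q) * (ln 2) ^+ 2 / 2 ^+ 15.

(** The exponent splits into contributions of [z], of the type and of the overlap. The gain, of
    order [u^14], outgrows the [u^12] error. *)
Lemma failure_exponent p q t u lg l (W f10 f11 : R) :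
  0 < p -> 0 < q -> q < 1 / 2 -> 0 < t -> 1 <= u ->
  0 < lg -> lg <= 32 * u / ln 2 -> l = ln ((1 - q) / q) ->
  W <= u ^+ 32 * (bconv (t / u ^+ 16) q * (1 + (u ^+ 8)^-1)) ->
  f10 <= t / u ^+ 16 * q * (1 + (u ^+ 4)^-1) ->
  t / u ^+ 16 * (1 - q) * (1 - (u ^+ 4)^-1) <= f11 ->
  t / u ^+ 16 * (expR (- l) * u ^+ 32 + (expR l - expR (- l)) * W
      + expR l * (1 / (8 * lg) + 2 * (1 / (8 * lg)) ^+ 2) * (p * u ^+ 32) - u ^+ 32)
  - (l * (u ^+ 32 * f11 - u ^+ 32 * f10)
      + 1 / (8 * lg) * (t / u ^+ 16 * u ^+ 32 * (p * (1 - q) / q)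
                        * (1 + 1 / (2 * lg))))
  <= - (l * t * (1 - 2 * q) * u ^+ 16) + exp_slack q t * u ^+ 12
     - exp_gain p q t * u ^+ 14.
Proof.
move=> p0 q0 q2 t0 u1 lg0 lgle lE Wle f10le f11ge.
have u0 : 0 < u by lra.
have ratio0 : 0 < (1 - q) / q by rewrite divr_gt0; lra.
have l0 : 0 <= l.
  by rewrite lE ln_ge0 // ler_pdivlMr //; lra.
have ln20 : 0 < ln 2 :> R by rewrite ln_gt0 // ltr1n.
have elE : expR l = (1 - q) / q by rewrite lE lnK ?posrE.
have enE : expR (- l) = q / (1 - q) by rewrite expRN elE invf_div.
rewrite elE enE.
have P1 := tilt_typicalZ q0 q2 t0 u1 Wle.
have P2 := tilt_typical_types t0 u1 l0 f10le f11ge.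
have P3 := tilt_overlap p t q0 u0 lg0.
set gain := t * _ * _ / (32 * _) in P3.
have gain_ge : exp_gain p q t * u ^+ 14 <= gain.
  have -> : exp_gain p q t * u ^+ 14
      = t * (p * (1 - q) / q) * u ^+ 16 / 32 * (ln 2 / (32 * u)) ^+ 2.
    by rewrite /exp_gain; field; rewrite !gt_eqF.
  have -> : gain = t * (p * (1 - q) / q) * u ^+ 16 / 32 * (lg^-1) ^+ 2.
    by rewrite /gain; field; rewrite !gt_eqF.
  have lgi : ln 2 / (32 * u) <= lg^-1.
    by rewrite -[leLHS]invrK invf_div lef_pV2 ?posrE // divr_gt0 ?mulr_gt0.
  have : 0 <= p * (1 - q) / q by rewrite divr_ge0 ?mulr_ge0; lra.
  move=> beta0; apply: ler_wpM2l.
    by apply: divr_ge0 => //; apply: mulr_ge0; [apply: mulr_ge0|rewrite exprn_ge0]; lra.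
  have x0 : 0 <= ln 2 / (32 * u) by apply: divr_ge0; lra.
  by rewrite lerXn2r // nnegrE; apply: le_trans lgi.
have ba0 : 0 <= (1 - q) / q - q / (1 - q).
  have -> : (1 - q) / q - q / (1 - q) = (1 - 2 * q) / (q * (1 - q)).
    by field; rewrite !gt_eqF //; lra.
  by rewrite divr_ge0 ?mulr_ge0; lra.
have slack_ge : ((1 - q) / q - q / (1 - q)) * (2 * t ^+ 2 + t * u ^+ 8)
    + l * t * u ^+ 12 <= exp_slack q t * u ^+ 12.
  rewrite /exp_slack -lE [leRHS]mulrDl [leLHS]addrC lerD2l -mulrA; apply: ler_wpM2l => //.
  have u12 : 1 <= u ^+ 12 by rewrite exprn_ege1.
  have u8 : u ^+ 8 <= u ^+ 12 by rewrite ler_weXn2l.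
  by nra.
have regroup (r A X m Y Z : R) :
    r * (A + X - m) - (Y + Z) = r * (A - m) + - Y + (r * X - Z) by ring.
rewrite regroup P3; lra.
Qed.

End Exponent.

(** * From single codewords to all noise words *)

Section Assembly.
Context {R : realType}.

Lemma ln_le_root32 (n : nat) (u : R) :
  0 < u -> u ^+ 32 = n%:R -> ln n%:R <= 32 * u.
Proof.
move=> u0 <-; rewrite lnXn // -[leLHS]mulr_natl; apply: ler_wpM2l => //.
by have := @le_ln1Dx R (u - 1); rewrite (addrC 1) subrK; lra.
Qed.

Lemma sqrt_root32 (n : nat) (u : R) :
  0 < u -> u ^+ 32 = n%:R -> Num.sqrt n%:R = u ^+ 16.
Proof. by move=> u0 <-; rewrite -[32%N]/(16 * 2)%N exprM sqrtr_sqr ger0_norm ?exprn_ge0 ?ltW. Qed.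

Lemma powR_root32 (n m k : nat) (u : R) :
  0 < u -> u ^+ 32 = n%:R -> (m * k = 32)%N -> n%:R `^ m%:R^-1 = u ^+ k.
Proof.
move=> u0 <- mk.
have m0 : (m%:R : R) != 0 by rewrite pnatr_eq0; case: (m) mk.
rewrite -mk mulnC exprM -powR_mulrn ?exprn_ge0 ?ltW // -powRrM divff //.
by rewrite powRr1 // exprn_ge0 // ltW.
Qed.

Lemma powR2E (x : R) : 2 `^ x = expR (x * ln 2).
Proof. by rewrite /powR pnatr_eq0. Qed.

(** Being listed refers to the whole codebook, whereas the overlap condition concerns one codeword
    only; this makes the counted events independent. *)
Lemma num_undecoded_le N L n (p q rho K : R) (C : codebook N L n)
    (T : {set word n}) (s : word n) :
  (forall x, x \in codom C -> x \in T ->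
     x \notin list_decoder p q rho C (xorw x s) -> K <= (overlap x s)%:R) ->
  (num_undecoded p q rho C T s
     <= \sum_(i < N) \sum_(j < L)
          ((C (i, j) \in T) && (K <= (overlap (C (i, j)) s)%:R)%R))%N.
Proof.
move=> TK; apply: leq_sum => i _; apply: leq_sum => j _.
case: (boolP (C (i, j) \in T)) => //= xT.
case: (boolP (_ \notin _)) => //= xL.
by rewrite TK ?codom_f.
Qed.

Lemma num_undecoded_prob N L n (p q rho K tau : R) (T : {set word n})
    (s : word n) (P : R) :
  0 <= rho <= 1 ->
  (forall (C : codebook N L n) x, x \in codom C -> x \in T ->
     x \notin list_decoder p q rho C (xorw x s) -> K <= (overlap x s)%:R) ->
  \sum_(x | (x \in T) && (K <= (overlap x s)%:R)) word_prob rho x <= P ->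
  (N * L)%:R * P <= tau / 4 ->
  code_prob rho (fun C : codebook N L n =>
    tau <= (num_undecoded p q rho C T s)%:R) <= expR (- (tau / 4)).
Proof.
move=> rho01 TK Ple mule.
pose B x := (x \in T) && (K <= (overlap x s)%:R).
apply: le_trans (le_trans (code_chernoff N L rho01 B tau) _).
  apply: code_prob_subset => // C /le_trans; apply.
  by rewrite ler_nat; apply: num_undecoded_le => x; exact: TK.
rewrite ler_expR.
have : (N * L)%:R * \sum_(x | B x) word_prob rho x <= (N * L)%:R * P.
  exact: ler_wpM2l.
lra.
Qed.

(** Union bound over all [2^n] words; those that are too heavy contribute an empty event. *)
Lemma code_prob_forall_wt N L n (p rho tau eps : R) (F : word n -> codebook N L n -> R) :
  0 <= rho <= 1 -> 0 <= eps ->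
  (forall s : word n, (wtH s)%:R <= p * n%:R ->
     code_prob rho (fun C => tau <= F s C) <= eps) ->
  1 - 2 ^+ n * eps <=
  code_prob rho (fun C => [forall s : word n, ((wtH s)%:R <= p * n%:R) ==> (F s C < tau)]).
Proof.
move=> rho01 eps0 Fle; rewrite code_prob_predC // lerD2l lerN2.
pose G (s : word n) (C : codebook N L n) :=
  ((wtH s)%:R <= p * n%:R) && (tau <= F s C).
apply: (@le_trans _ _ (\sum_s code_prob rho (G s))).
  apply: le_trans (code_prob_exists rho01 G).
  apply: code_prob_subset => // C /=; rewrite negb_forall => /existsP[s].
  by rewrite negb_imply -leNgt => sC; apply/existsP; exists s.
have -> : 2 ^+ n * eps = \sum_(s : word n) eps.
  by rewrite sumr_const card_ffun card_bool card_ord -[RHS]mulr_natl natrX.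
apply: ler_sum => s _; rewrite /G; case: (boolP ((wtH s)%:R <= _)) => [/Fle//|_] /=.
by rewrite /code_prob big_pred0.
Qed.

End Assembly.

(** * Numerical estimates for large [u] *)

Section Asymptotics.
Context {R : realType}.
Implicit Types u g slack gain : R.

(** [105 = 8 + 96 + 1] collects the lower-order terms, each bounded by a multiple of [u^12]. *)
Lemma failure_exponent_le u slack gain :
  0 <= slack -> 0 < gain -> 1 <= u -> (slack + 105) / gain <= u ->
  8 + 96 * u + slack * u ^+ 12 - gain * u ^+ 14 <= - u ^+ 8.
Proof.
move=> slack0 gain0 u1; rewrite ler_pdivrMr // => ule.
have u0 : 0 <= u by lra.
have u12 : 1 <= u ^+ 12 by rewrite exprn_ege1.
have uu12 : u <= u ^+ 12 by rewrite -[leLHS]expr1 ler_weXn2l.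
have u8 : u ^+ 8 <= u ^+ 12 by rewrite ler_weXn2l.
have u13 : u ^+ 12 * u <= u ^+ 14.
  by rewrite -exprSr ler_weXn2l.
have : u ^+ 12 * (slack + 105) <= u ^+ 12 * (u * gain).
  by apply: ler_wpM2l => //; lra.
have : gain * (u ^+ 12 * u) <= gain * u ^+ 14 by apply: ler_wpM2l => //; lra.
by lra.
Qed.

(** Rounding costs [N <= 2 exp r], the list factor costs [n^3 <= exp (96 u)], and [exp 8 >= 8]
    covers this 2 and the final 4. *)
Lemma mean_le N n u r a (tau P : R) :
  0 < u -> u ^+ 32 = n%:R -> 0 <= r ->
  `|N%:R - expR r| < 1 -> P <= expR a ->
  8 + 96 * u + r + a <= tau -> (N * n ^ 3)%:R * P <= expR tau / 4.
Proof.
move=> u0 un r0 Nr Pa le_tau.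
have n0 : 0 < (n%:R : R) by rewrite -un exprn_gt0.
have r1 : 1 <= expR r by rewrite -[leLHS]expR0 ler_expR.
have Nle : N%:R <= 2 * expR r.
  by move: Nr; rewrite ltr_norml; lra.
have n3 : (n ^ 3)%:R <= expR (96 * u).
  have -> : 96 * u = 32 * u *+ 3 by rewrite -[RHS]mulr_natl; lra.
  rewrite natrX -[_ *+ 3]mulr_natl expRM_natl lerXn2r ?nnegrE ?expR_ge0 //.
  rewrite -[leLHS]lnK ?posrE // ler_expR; exact: ln_le_root32.
have e8 : 8 <= expR (8 : R) by apply: le_trans (expR_ge1Dx _); lra.
have : expR (8 + 96 * u + r + a) <= expR tau by rewrite ler_expR.
rewrite (expRD _ a) (expRD _ r) (expRD 8); set e := expR 8 in e8 *; set x := expR (96 * u) in n3 *.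
set y := expR r in Nle r1 *; set z := expR a in Pa *.
have z0 : 0 < z by exact: expR_gt0.
have x0 : 0 < x by exact: expR_gt0.
have y0 : 0 < y by exact: expR_gt0.
have : 8 * (x * y * z) <= e * (x * y * z).
  by rewrite ler_wpM2r // ltW // !mulr_gt0.
have NP : (N * n ^ 3)%:R * P <= 2 * y * x * z.
  apply: (@le_trans _ _ ((N * n ^ 3)%:R * z)); first exact: ler_wpM2l.
  rewrite ler_pM2r // natrM; apply: ler_pM => //.
move=> h1 h2; apply: le_trans NP _; lra.
Qed.

(** With [X = exp (g sqrt n / 4)], the threshold is at least [X^2], and [X >= n >= 8] gives
    [n - X^2 / 4 <= - X]. *)
Lemma union_bound_le n u g :
  0 < g -> 2 <= u -> u ^+ 32 = n%:R -> 128 / g <= u ->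
  2 ^+ n * expR (- (expR (g * u ^+ 16 - u ^+ 8) / 4))
  <= expR (- expR (g * u ^+ 16 / 4)).
Proof.
move=> g0 u2 un; rewrite ler_pdivrMr // => ug.
have u0 : 0 < u by lra.
have n0 : 0 < (n%:R : R) by rewrite -un exprn_gt0.
have u8 : u <= u ^+ 8 by rewrite -[leLHS]expr1 ler_weXn2l //; lra.
have u16E : u ^+ 16 = u ^+ 8 * u ^+ 8 by rewrite -exprD.
have n8 : 8 <= (n%:R : R).
  have -> : 8 = (2 : R) ^+ 3 by rewrite -natrX.
  rewrite -un; apply: (@le_trans _ _ (u ^+ 3)).
    by rewrite lerXn2r ?nnegrE //; lra.
  by rewrite ler_weXn2l //; lra.
have gu : 128 * u ^+ 8 <= g * u ^+ 16.
  rewrite u16E mulrA; apply: ler_wpM2r; first by lra.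
  by have := ler_wpM2l (ltW g0) u8; lra.
set X := expR (g * u ^+ 16 / 4).
have nX : n%:R <= X.
  rewrite -[leLHS]lnK ?posrE // ler_expR.
  by have := ln_le_root32 u0 un; lra.
have XX : X * X <= expR (g * u ^+ 16 - u ^+ 8).
  by rewrite -expRD ler_expR; lra.
have e2 : 2 ^+ n <= expR n%:R :> R.
  rewrite -[X in expR X]mulr1 expRM_natl.
  by rewrite lerXn2r ?nnegrE ?expR_ge0 //; have := expR_ge1Dx (1 : R); lra.
apply: le_trans (ler_wpM2r (expR_ge0 _) e2) _.
rewrite -expRD ler_expR; nra.
Qed.

End Asymptotics.

(** * The bound at a fixed length, then the limit *)

Section Main.
Context {R : realType} (p q eps_d delta : R).
Let t := t_par q eps_d.
Let c := c_par p q eps_d delta.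
Let l := ln ((1 - q) / q).
Let beta := p * (1 - q) / q.
Let g := c * ln 2.

(** [c + delta] equals [t (I_B - I_J)], and both it and the second factor are positive. *)
Lemma t_par_gt0 : I_J q < I_B p q -> 0 < delta -> 0 < c -> 0 < t.
Proof.
rewrite /c /c_par /rate -/t => IJB d0 c0.
by rewrite -(pmulr_lgt0 t (x := I_B p q - I_J q)) ?subr_gt0 //; lra.
Qed.

Lemma undecoded_union_bound (n N : nat) (u : R) (z : word n) (f10 f11 : R) :
  0 < p -> p < q -> q < 1 / 2 -> 0 < t -> 0 < c -> u ^+ 32 = n%:R -> 2 <= u -> t <= u ->
  64 / (beta * ln 2) <= u -> 128 / g <= u ->
  (exp_slack q t + 105) / exp_gain p q t <= u ->
  `|N%:R - 2 `^ (rate p q eps_d delta * Num.sqrt n%:R)| < 1 ->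
  z \in typicalZ n (rho_par q eps_d n) q ->
  typical_types n (rho_par q eps_d n) q (f10, f11) ->
  1 - expR (- 2 `^ (c / 4 * Num.sqrt n%:R)) <=
  code_prob (rho_par q eps_d n)
    (fun C : codebook N (n ^ 3) n =>
      [forall s : word n, ((wtH s)%:R <= p * n%:R) ==>
        ((num_undecoded p q (rho_par q eps_d n) C (type_class z f10 f11) s)%:R
         < expR (- n%:R `^ 4^-1) * 2 `^ (c * Num.sqrt n%:R))]).
Proof.
move=> p0 pq q2 t0 c0 un u2 tu ubeta ug ugain Nr zT fT.
have u0 : 0 < u by lra.
have u1 : 1 <= u by lra.
have q0 : 0 < q by lra.
have ln20 : 0 < ln 2 :> R by rewrite ln_gt0 // ltr1n.
have q1 : q < 1 by lra.
have g0 : 0 < g by rewrite mulr_gt0.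
have beta0 : 0 < beta by rewrite divr_gt0 ?mulr_gt0 //; lra.
have ratio1 : 1 < (1 - q) / q by rewrite ltr_pdivlMr //; lra.
have l0 : 0 < l by rewrite ln_gt0.
have gain0 : 0 < exp_gain p q t.
  by rewrite /exp_gain -/beta divr_gt0 ?exprn_gt0 // mulr_gt0 ?exprn_gt0 // mulr_gt0.
have ba0 : 0 <= (1 - q) / q - q / (1 - q).
  have -> : (1 - q) / q - q / (1 - q) = (1 - 2 * q) / (q * (1 - q)).
    by field; rewrite !gt_eqF //; lra.
  by rewrite divr_ge0 ?mulr_ge0; lra.
have slack0 : 0 <= exp_slack q t.
  rewrite /exp_slack -/l; apply: addr_ge0; first by rewrite mulr_ge0 ?ltW.
  by apply: mulr_ge0 => //; have := sqr_ge0 t; lra.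
have n0 : 0 < (n%:R : R) by rewrite -un exprn_gt0.
have n2 : 2 <= (n%:R : R).
  by rewrite -un; apply: le_trans u2 _; rewrite -[leLHS]expr1 ler_weXn2l.
have n1 : (1 < n)%N by rewrite -(ltr_nat R); lra.
have rhoE : rho_par q eps_d n = t / u ^+ 16.
  by rewrite /rho_par (sqrt_root32 u0 un).
have u16 : u <= u ^+ 16 by rewrite -[leLHS]expr1 ler_weXn2l.
have u16_gt0 : 0 < u ^+ 16 by rewrite exprn_gt0.
have rho0 : 0 <= t / u ^+ 16 by rewrite divr_ge0 // ltW.
(* The threshold [t <= u] makes [rho] a probability. *)
have rho01 : 0 <= t / u ^+ 16 <= 1.
  by rewrite rho0 ler_pdivrMr //= mul1r; lra.
set lg := log2 (n%:R : R).
have lg1 : 1 <= lg by rewrite /lg /log2 ler_pdivlMr // mul1r ler_ln ?posrE.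
have lg0 : 0 < lg by lra.
have lgle : lg <= 32 * u / ln 2.
  by rewrite /lg /log2 ler_pM2r ?invr_gt0 //; exact: ln_le_root32.
have pow4 : n%:R `^ (- 4^-1) = (u ^+ 8)^-1 by rewrite powRN (powR_root32 u0 un (k := 8)).
have pow8 : n%:R `^ (- 8^-1) = (u ^+ 4)^-1 by rewrite powRN (powR_root32 u0 un (k := 4)).
have Wle : (wtH z)%:R <= u ^+ 32 * (bconv (t / u ^+ 16) q * (1 + (u ^+ 8)^-1)).
  move: zT; rewrite inE rhoE pow4 => /andP[_].
  by rewrite /freq1 ler_pdivrMr // un mulrC.
move: fT; rewrite /typical_types /= rhoE pow8.
case=> _ _ /andP[f10ge f10le] /andP[f11ge f11le].
rewrite (sqrt_root32 u0 un) (powR_root32 u0 un (k := 8)) // !powR2E.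
have -> : c / 4 * u ^+ 16 * ln 2 = g * u ^+ 16 / 4 by rewrite /g; lra.
have -> : c * u ^+ 16 * ln 2 = g * u ^+ 16 by rewrite /g; lra.
set tau := expR (- u ^+ 8) * expR (g * u ^+ 16).
have tauE : tau = expR (g * u ^+ 16 - u ^+ 8) by rewrite /tau -expRD addrC.
set a := - (l * t * (1 - 2 * q) * u ^+ 16) + exp_slack q t * u ^+ 12
     - exp_gain p q t * u ^+ 14.
set r := g * u ^+ 16 + l * t * (1 - 2 * q) * u ^+ 16.
have ltq0 : 0 <= l * t * (1 - 2 * q) by apply: mulr_ge0; [rewrite mulr_ge0 ?ltW|lra].
have r0 : 0 <= r by rewrite /r; apply: addr_ge0; apply: mulr_ge0 => //; exact: ltW.
(* Since the rate is [c + t I_J], the [I_J] terms of [r] and [a] cancel in the mean, leaving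
   [g u^16]. *)
have rE : rate p q eps_d delta * u ^+ 16 * ln 2 = r.
  rewrite /r /g /c /c_par -/t /I_J /log2 -/l.
  by field; rewrite gt_eqF.
move: Nr; rewrite (sqrt_root32 u0 un) powR2E rE => Nr.
have mule : (N * n ^ 3)%:R * expR a <= tau / 4.
  rewrite tauE; apply: (mean_le u0 un r0 Nr (lexx _)).
  by have := failure_exponent_le slack0 gain0 u1 ugain; rewrite /r /a; lra.
(* This makes the weight deficit [n^(-1/8)] of a typical type at most [beta / (2 lg)]. *)
have vle : 2 * lg <= beta * u ^+ 4.
  have ub : 64 <= u * (beta * ln 2) by rewrite -ler_pdivrMr // mulr_gt0.
  have uu : u * u <= u ^+ 4 by rewrite -expr2 ler_weXn2l.
  apply: (@le_trans _ _ (64 * u / ln 2)); first by lra.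
  rewrite ler_pdivrMr //; apply: (@le_trans _ _ (u * (u * (beta * ln 2)))).
    by rewrite mulrC ler_pM2l.
  have := ler_wpM2r (ltW (mulr_gt0 beta0 ln20)) uu; lra.
have v_le : (u ^+ 4)^-1 <= beta / (2 * lg).
  have lg2 : 0 < 2 * lg by lra.
  by rewrite ler_pdivlMr // mulrC ler_pdivrMr ?exprn_gt0.
have w_ge : t / u ^+ 16 * n%:R * (1 - (u ^+ 4)^-1) <= n%:R * f10 + n%:R * f11.
  rewrite -mulrDr (mulrAC _ n%:R) mulrC; apply: ler_wpM2l => //.
  by have := lerD f10ge f11ge; lra.
set K := t / u ^+ 16 * u ^+ 32 * beta * (1 + 1 / (2 * lg)).
apply: le_trans (code_prob_forall_wt (eps := expR (- (tau / 4))) rho01 (expR_ge0 _) _).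
  by rewrite lerD2l lerN2 tauE; exact: union_bound_le.
move=> s sp.
apply: (num_undecoded_prob (K := K) (P := expR a)) => //.
  move=> C x xC xT xL; rewrite /K un.
  exact: (undecoded_overlap p0 pq q1 rho0 n1 v_le w_ge xC xT xL).
have lam01 : 0 <= 1 / (8 * lg) <= 2^-1.
  have lg8 : 0 < 8 * lg by lra.
  by rewrite divr_ge0 ?(ltW lg8) //= ler_pdivrMr //; lra.
apply: le_trans (type_overlap_prob z f10 f11 K rho01 (ltW l0) lam01 sp) _.
rewrite ler_expR /K -un.
by apply: failure_exponent => //; lra.
Qed.

End Main.

Lemma root32K {R : realType} (n : nat) : (n%:R `^ 32^-1) ^+ 32 = n%:R :> R.
Proof. by rewrite -powR_mulrn ?powR_ge0 // -powRrM mulVf ?powRr1 ?pnatr_eq0. Qed.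

Lemma root32_pinfty {R : realType} (M : R) :
  \forall n \near \oo, M <= n%:R `^ 32^-1.
Proof.
near=> n.
(* The maximum with 0 handles negative [M], as the even power is monotone only on nonnegative
   reals. *)
have : (Num.max 0 M) ^+ 32 <= (n%:R `^ 32^-1) ^+ 32.
  by rewrite root32K; near: n; exact: nbhs_infty_ger.
rewrite ler_pXn2r ?nnegrE ?powR_ge0 ?le_max ?lexx // ge_max.
by case/andP.
Unshelve. all: by end_near.
Qed.

Theorem claim5 (R : realType) (p q eps_d delta : R) :
  0 < p -> p < q -> q < 1 / 2 ->
  0 < eps_d < 1 ->
  I_J q < I_B p q ->
  0 < delta -> 0 < c_par p q eps_d delta ->
  exists2 kappa : R, 0 < kappa &
  \forall n \near \oo,
  forall N : nat,
    `|N%:R - 2 `^ (rate p q eps_d delta * Num.sqrt n%:R)| < 1 ->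
  forall (z : word n) (f10 f11 : R),
    z \in typicalZ n (rho_par q eps_d n) q ->
    typical_types n (rho_par q eps_d n) q (f10, f11) ->
  1 - expR (- 2 `^ (kappa * Num.sqrt n%:R)) <=
  code_prob (rho_par q eps_d n)
    (fun C : codebook N (n ^ 3) n =>
      [forall s : word n, ((wtH s)%:R <= p * n%:R) ==>
        ((num_undecoded p q (rho_par q eps_d n) C (type_class z f10 f11) s)%:R
         < expR (- n%:R `^ 4^-1)
           * 2 `^ (c_par p q eps_d delta * Num.sqrt n%:R))]).
Proof.
move=> p0 pq q2 _ IJB delta0 c0.
(* The quarter is that of [X] in the union bound. *)
exists (c_par p q eps_d delta / 4); first by rewrite divr_gt0.
have t0 := t_par_gt0 IJB delta0 c0.
(* All thresholds depend on the parameters alone, so [n] is fixed before [N], [z] and the type. *)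
near=> n => N Nr z f10 f11 zT fT.
apply: (@undecoded_union_bound _ p q eps_d delta n N (n%:R `^ 32^-1)) => //.
- exact: root32K.
- by near: n; exact: root32_pinfty.
- by near: n; exact: root32_pinfty.
- by near: n; exact: root32_pinfty.
- by near: n; exact: root32_pinfty.
- by near: n; exact: root32_pinfty.
Unshelve. all: by end_near.
Qed.
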